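(* Let $R$ be a finite chain ring with maximal ideal $\langle\gamma\rangle$, residue field $\mathbb{F}_q$ and reduction map $\mu: R\to \mathbb{F}_q$, and let $n$ be a positive integer with $\gcd(n,q)=1$. (1) Let $\lambda\in\mathbb{F}_q^*$ be such that there exists $\delta\in\mathbb{F}_q^*$ with $\delta^n=\lambda$. Then there exist units $\lambda_0,\delta_0\in R^*$ such that $\lambda_0=\delta_0^n$ and $\mu(\lambda_0)=\lambda$. Further, every $\lambda_0$-constacyclic code of length $n$ over $R$ is equivalent to a cyclic code of length $n$ over $R$. (2) Conversely, let $\lambda\in R$ be a unit such that there exists a unit $\delta\in R$ with $\delta^n=\lambda$. Then every $\mu(\lambda)$-constacyclic code of length $n$ over $\mathbb{F}_q$ is equivalent to a cyclic code of length $n$ over $\mathbb{F}_q$.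
   Context: A finite chain ring is a finite commutative local principal ideal ring $R$ with $1\neq 0$ whose ideals are totally ordered by inclusion; its maximal ideal is $\langle\gamma\rangle$, its unit group is $R^*=R\setminus\langle\gamma\rangle$, and $\mu:R\to R/\langle\gamma\rangle=\mathbb{F}_q$ is the natural surjection. A (linear) code of length $n$ over a ring $A$ is an $A$-submodule of $A^n$. For a unit $\lambda\in A$, a linear code $C\subseteq A^n$ is $\lambda$-constacyclic if $(\lambda c_{n-1},c_0,\ldots,c_{n-2})\in C$ whenever $(c_0,\ldots,c_{n-1})\in C$; identifying $(c_0,\ldots,c_{n-1})$ with $c_0+c_1x+\cdots+c_{n-1}x^{n-1}$, these are the ideals of $A[x]/\langle x^n-\lambda\rangle$. Cyclic means $1$-constacyclic. Two codes of length $n$ over $A$ are equivalent if one is mapped onto the other by a monomial transformation of $A^n$, i.e. a permutation of coordinates composed with multiplication of each coordinate by a unit of $A$. *)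

(* Defs.v *)
From HB Require Import structures.
From mathcomp Require Import all_boot all_order all_fingroup all_algebra.

Set Implicit Arguments.
Unset Strict Implicit.
Unset Printing Implicit Defensive.

Import GRing.Theory.
Local Open Scope ring_scope.

Section ChainRing.
Variable R : finComUnitRingType.
Implicit Types (I J M : {set R}) (a : R).

(* Unlike [idealr_closed], this does not require ideals to be proper. *)
Definition ideal I : Prop := @GRing.submod_closed R R^o (mem I).

Definition principal_ideal a : {set R} := [set r * a | r : R].

Definition maximal_ideal M : Prop :=
  [/\ ideal M, M != setT
    & forall J, ideal J -> M \subset J -> J = M \/ J = setT].

Definition local_ring : Prop := exists! M, maximal_ideal M.

Definition principal_ideal_ring : Prop :=
  forall I, ideal I -> exists a, I = principal_ideal a.

Definition ideals_totally_ordered : Prop :=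
  forall I J, ideal I -> ideal J -> I \subset J \/ J \subset I.

(* R is finite, commutative and satisfies 1 != 0 by its type. *)
Definition finite_chain_ring : Prop :=
  [/\ local_ring, principal_ideal_ring & ideals_totally_ordered].

End ChainRing.

(* F, together with mu, is the residue ring R / <g>, up to a unique
   isomorphism compatible with the projections. *)
Definition residue_map (R : finComUnitRingType) (g : R) (F : finFieldType)
    (mu : {rmorphism R -> F}) : Prop :=
  (forall y : F, exists x : R, mu x = y)
  /\ (forall x : R, mu x = 0 <-> x \in principal_ideal g).

Section Codes.
Variables (A : finComUnitRingType) (n : nat).
Implicit Types (C D : {set 'rV[A]_n}) (c : 'rV[A]_n) (lambda : A).

Definition linear_code C : Prop := GRing.submod_closed (mem C).

(* (c_0, ..., c_(n-1)) |-> (lambda c_(n-1), c_0, ..., c_(n-2)); here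
   [ord_pred i] is i - 1 for i > 0, and n - 1 for i = 0. *)
Definition constacyclic_shift lambda c : 'rV[A]_n :=
  \row_i (if i == 0%N :> nat then lambda * c 0 (ord_pred i)
          else c 0 (ord_pred i)).

Definition constacyclic lambda C : Prop :=
  linear_code C /\ (forall c, c \in C -> constacyclic_shift lambda c \in C).

Definition cyclic_code C : Prop := constacyclic 1 C.

Definition monomial_map (s : 'S_n) (u : 'I_n -> A) c : 'rV[A]_n :=
  \row_i (u i * c 0 (s i)).

Definition code_equivalent C D : Prop :=
  exists (s : 'S_n) (u : 'I_n -> A),
    (forall i, u i \is a GRing.unit) /\ D = monomial_map s u @: C.

Definition equivalent_to_cyclic C : Prop :=
  exists D, cyclic_code D /\ code_equivalent C D.

End Codes.

(* Main.v *)
(* If lambda = delta^n, the substitution x := delta x is an isomorphism from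
   A[x]/(x^n - lambda) onto A[x]/(x^n - 1); on coefficients it is the diagonal
   monomial map with entries 1, delta, ..., delta^(n-1).  For part (1), any lift
   of delta to R is a unit, since it lies outside the maximal ideal. *)
Require Import Defs.
From HB Require Import structures.
From mathcomp Require Import all_boot all_order all_fingroup all_algebra.

Set Implicit Arguments.
Unset Strict Implicit.
Unset Printing Implicit Defensive.

Import GRing.Theory.
Local Open Scope ring_scope.

Section ChainRingUnits.
Variable R : finComUnitRingType.
Implicit Types a g : R.

Lemma ideal_principal a : ideal (principal_ideal a).
Proof.
split; first by apply/imsetP; exists 0; rewrite ?mul0r.
move=> r _ _ /imsetP[x _ ->] /imsetP[y _ ->].
by apply/imsetP; exists (r * x + y); rewrite // mulrDl -mulrA.
Qed.

Lemma mem_principal_ideal a : a \in principal_ideal a.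
Proof. by apply/imsetP; exists 1; rewrite ?mul1r. Qed.

(** Comparability leaves only [<g>] inside [<a>], as the other inclusion puts [a] in [<g>].
    Maximality then forces [<a>] to be the whole ring, so 1 is a multiple of [a]. *)
Lemma chain_ring_unit g a :
  @ideals_totally_ordered R -> maximal_ideal (principal_ideal g) ->
  a \notin principal_ideal g -> a \is a GRing.unit.
Proof.
move=> ordR [_ _ maxg] a_notin.
have ida := ideal_principal a.
have [sga | sag] := ordR _ _ (ideal_principal g) ida; last first.
  by case/negP: a_notin; apply: (subsetP sag); apply: mem_principal_ideal.
have [eq_ag | eq_aT] := maxg _ ida sga.
  by case/negP: a_notin; rewrite -eq_ag mem_principal_ideal.
have /imsetP[r _ ra1] : 1 \in principal_ideal a by rewrite eq_aT in_setT.
by apply/unitrPr; exists r; rewrite mulrC.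
Qed.

End ChainRingUnits.

Section ConstacyclicPower.
Variables (A : finComUnitRingType) (n : nat) (delta : A).
Hypothesis delta_unit : delta \is a GRing.unit.

Let phi : 'rV[A]_n -> 'rV[A]_n :=
  monomial_map 1%g (fun i : 'I_n => delta ^+ i).

(** In polynomial terms [phi] sends c(x) to c(delta x), and x c(delta x) = delta^-1 (delta x)
    c(delta x): multiplication by x commutes with [phi] up to the scalar delta^-1. *)
Lemma constacyclic_shift_monomial c :
  constacyclic_shift 1 (phi c) =
  phi (delta^-1 *: constacyclic_shift (delta ^+ n) c).
Proof.
apply/rowP => i; rewrite !mxE !perm1.
case: (posnP i) => [i0 | i_gt0].
  (* At the wrap-around, [phi] contributes delta^(n-1), which is delta^-1 times the constant delta^n
     of the shift. *)
  have ->: (ord_pred i : nat) = n.-1.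
    by rewrite /= i0 add0n modn_small // ltn_predL (leq_ltn_trans _ (ltn_ord i)).
  have ->: delta ^+ n = delta * delta ^+ n.-1.
    by rewrite -exprS prednK // (leq_ltn_trans _ (ltn_ord i)).
  by rewrite i0 !mul1r !mulrA mulVr ?mul1r.
have ->: (ord_pred i : nat) = i.-1.
  by rewrite /= -subn1 -addnBAC // modnDr subn1 modn_small //
             (leq_ltn_trans (leq_pred _)).
by rewrite -{2}(prednK i_gt0) exprSr mulrA mulrK.
Qed.

Lemma constacyclic_power_equivalent (C : {set 'rV[A]_n}) :
  constacyclic (delta ^+ n) C -> equivalent_to_cyclic C.
Proof.
move=> [[C0 C_lin] C_shift]; exists (phi @: C); split; last first.
  exists 1%g, (fun i : 'I_n => delta ^+ i).
  by split=> // i; apply: unitrX.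
split; first split.
- apply/imsetP; exists 0; first exact: C0.
  by apply/rowP => i; rewrite !mxE mulr0.
- move=> a _ _ /imsetP[c cC ->] /imsetP[d dC ->].
  apply/imsetP; exists (a *: c + d); first exact: C_lin.
  by apply/rowP => i; rewrite !mxE mulrDr !mulrA (mulrC a).
move=> _ /imsetP[c cC ->]; rewrite constacyclic_shift_monomial.
(* The stray scalar delta^-1 is absorbed by linearity; adding 0 gives the form a u + v that [C_lin]
   expects. *)
by apply: imset_f; rewrite -[_ *: _]addr0; apply: C_lin; rewrite ?C_shift.
Qed.

End ConstacyclicPower.

Theorem theorem4p3 (R : finComUnitRingType) (gamma : R) (F : finFieldType)
    (mu : {rmorphism R -> F}) (n : nat)
    (hR : finite_chain_ring R)
    (hgamma : maximal_ideal (principal_ideal gamma))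
    (hmu : residue_map gamma mu)
    (hn : (0 < n)%N)
    (hcop : coprime n #|F|) :
  (forall lambda : F, lambda \is a GRing.unit ->
     (exists delta : F, delta \is a GRing.unit /\ delta ^+ n = lambda) ->
     exists lambda0 delta0 : R,
       [/\ lambda0 \is a GRing.unit, delta0 \is a GRing.unit,
           lambda0 = delta0 ^+ n, mu lambda0 = lambda
         & forall C : {set 'rV[R]_n},
             constacyclic lambda0 C -> equivalent_to_cyclic C])
  /\
  (forall lambda : R, lambda \is a GRing.unit ->
     (exists delta : R, delta \is a GRing.unit /\ delta ^+ n = lambda) ->
     forall C : {set 'rV[F]_n},
       constacyclic (mu lambda) C -> equivalent_to_cyclic C).
Proof.
split=> [lambda _ [delta [delta_unit <-]] | _ _ [delta [delta_unit <-]] C].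
  have [[_ _ ordR] [mu_surj mu_ker]] := (hR, hmu).
  have [d mu_d] := mu_surj delta.
  have d_unit : d \is a GRing.unit.
    (* A lift inside [<gamma>] would give delta = [mu d] = 0, which is not a unit. *)
    apply: (chain_ring_unit ordR hgamma); apply/negP => /mu_ker mu_d0.
    by move: delta_unit; rewrite -mu_d mu_d0 unitr0.
  exists (d ^+ n), d; split=> //.
  - exact: unitrX.
  - by rewrite rmorphXn mu_d.
  - by move=> C; apply: constacyclic_power_equivalent.
(* Over [F], the unit [mu delta] serves as the n-th root. *)
by rewrite rmorphXn; apply: constacyclic_power_equivalent; apply: rmorph_unit.
Qed.
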